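(* Let $m\geq 1$ and $j\geq 1$ be integers with $j\geq \frac{2m-1+\sqrt{8m^2+1}}{2}$. Let $g_{j,k}$ ($k\geq 0$, $g_{j,0}=1$) be the coefficients in the Laurent series in $q$ $$-\xi_j=-q^{-j}+(-1)^jq^{j(j-1)/2}\Big(1+\sum_{k=1}^{\infty}g_{j,k}q^k\Big)$$ of the $j$-th zero $x=-\xi_j(q)$ of the partial theta function $\theta(q,x)=\sum_{i=0}^{\infty}q^{i(i+1)/2}x^i$. Let $\tilde r_{k;m,j}$ ($k\geq 0$) be the coefficients of the power series $$\sum_{k=0}^{\infty}\tilde r_{k;m,j}q^k=\Big(\sum_{k=0}^{\infty}r_kq^k\Big)\Big(1-q^{j+1}+q^{2j+3}-\cdots+(-1)^{m-1}q^{(m-1)j+m(m-1)/2}\Big),$$ where the integers $r_k$ are defined by $r_0=1$, $r_k=0$ for $k<0$, and $r_k=\sum_{\nu=1}^{\infty}(-1)^{\nu-1}(2\nu+1)\,r_{k-\nu(\nu+1)/2}$ for $k\geq 1$. Then for every integer $k$ with $0\leq k\leq \frac{(m+2j)(m+1)}{2}-1-j$ one has $$g_{j,k}=\tilde r_{k;m,j}.$$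
   Context: The partial theta function is $\theta(q,x):=\sum_{i=0}^{\infty}q^{i(i+1)/2}x^i$, where $q\in\mathbb{C}$, $|q|<1$, is a parameter and $x\in\mathbb{C}$ is a variable; for each fixed $q$ it is an entire function of $x$. Indexing of zeros (known facts that fix the notation): for $0<|q|\leq 0.108$ all zeros of $\theta(q,\cdot)$ are distinct, and they can be indexed by the order of the pole at $q=0$ which they have as functions of $q$. For each integer $j\geq 1$, the $j$-th zero, denoted $-\xi_j=-\xi_j(q)$, is the one with a pole of order $j$ at $q=0$. It satisfies $\theta(q,-\xi_j(q))=0$ and can be expanded in a Laurent series at $q=0$ of the form $-\xi_j=-q^{-j}+(-1)^jq^{j(j-1)/2}(1+\sum_{k=1}^{\infty}g_{j,k}q^k)$; this defines the coefficients $g_{j,k}$, and one sets $g_{j,0}=1$. The alternating polynomial factor in the definition of $\tilde r_{k;m,j}$ is $\sum_{s=0}^{m-1}(-1)^sq^{sj+s(s+1)/2}$ (for $m=1$ it equals $1$). *)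

(* Defs.v *)
From Stdlib Require Import Reals ZArith List Arith.
From Coquelicot Require Import Coquelicot.

Definition tri (n : nat) : nat := (n * (n + 1) / 2)%nat.

(* [is_theta q x l]: the series defining theta(q, x) converges to [l].  For
   [Cmod q < 1] it converges for every [x]. *)
Definition is_theta (q x l : C) : Prop :=
  @is_series C_AbsRing C_NormedModule (fun i : nat => (q ^ tri i * x ^ i)%C) l.

Definition holomorphic_at (f : C -> C) (z : C) : Prop :=
  @ex_derive C_AbsRing C_NormedModule f z.

Definition pole_at_0 (n : nat) (f : C -> C) : Prop :=
  (1 <= n)%nat /\
  exists (h : C -> C) (rho : R),
    (0 < rho)%R /\
    (forall q : C, (Cmod q < rho)%R -> holomorphic_at h q) /\
    h 0%C <> 0%C /\
    (forall q : C, (0 < Cmod q < rho)%R -> f q = (h q / q ^ n)%C).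

(* For 0 < |q| <= 0.108 the zeros of theta(q, .) are distinct and the j-th one
   is, as a function of q, characterized by its pole of order j at q = 0. *)
Definition jth_zero (j : nat) (z : C -> C) : Prop :=
  (forall q : C, (0 < Cmod q <= 108 / 1000)%R -> is_theta q (z q) 0%C) /\
  pole_at_0 j z.

(* The Laurent expansion
     - xi = - q^(-j) + (-1)^j q^(j(j-1)/2) (sum_{k >= 0} g_k q^k),  g_0 = 1,
   is required on some punctured disc centred at 0. *)
Definition laurent_coeffs (j : nat) (xi : C -> C) (g : nat -> C) : Prop :=
  g 0%nat = 1%C /\
  exists rho : R,
    (0 < rho)%R /\
    forall q : C, (0 < Cmod q < rho)%R ->
      exists S : C,
        @is_series C_AbsRing C_NormedModule (fun k : nat => (g k * q ^ k)%C) S /\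
        (- xi q = - / q ^ j + (- (1)) ^ j * q ^ (j * (j - 1) / 2) * S)%C.

(* f a + f (a + 1) + ... + f (a + n - 1) *)
Definition Zsum (a n : nat) (f : nat -> Z) : Z :=
  fold_right Z.add 0%Z (map f (seq a n)).

(* The sum over all nu >= 1 in the recurrence is stopped at nu = k: for nu > k
   the index k - nu(nu+1)/2 is negative, so those terms vanish. *)
Definition is_r (r : Z -> Z) : Prop :=
  r 0%Z = 1%Z /\
  (forall k : Z, (k < 0)%Z -> r k = 0%Z) /\
  (forall k : Z, (1 <= k)%Z ->
     r k = Zsum 1 (Z.to_nat k) (fun nu : nat =>
             ((-1) ^ Z.of_nat (nu - 1) * (2 * Z.of_nat nu + 1)
              * r (k - Z.of_nat (tri nu)))%Z)).

(* Coefficient of q^i in sum_{s < m} (-1)^s q^(s j + s(s+1)/2). *)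
Definition alt_coeff (m j i : nat) : Z :=
  Zsum 0 m (fun s : nat =>
    if Nat.eqb (s * j + tri s) i then ((-1) ^ Z.of_nat s)%Z else 0%Z).

(* Cauchy product of (sum_k r_k q^k) with that polynomial. *)
Definition rtilde (r : Z -> Z) (m j k : nat) : Z :=
  Zsum 0 (k + 1) (fun i : nat =>
    (r (Z.of_nat i) * alt_coeff m j (k - i))%Z).

(* Main.v *)
Require Import Defs.
From Stdlib Require Import Reals ZArith.
From Coquelicot Require Import Coquelicot.
From Stdlib Require Import Lia Lra List.

(** Put [x = - q^(-j) (1 - d)].  Then [q^(j(j-1)/2) theta(q, x)] is the sum over
    [i] of [(-1)^i q^((i-j)(i-j+1)/2) (1 - d)^i].  The exponent is invariant
    under [i -> 2j - 1 - i], which changes the sign, so for [i < 2j] the constant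
    terms cancel in pairs and the linear ones add up to [- (-1)^j d D(q)], where
    [D] is the [j]-th partial sum of Jacobi's series
    [1 - 3 q + 5 q^3 - 7 q^6 + ...], whose inverse generates the [r_k].  The terms
    [i = 2j + s] give [q^(j(j+1)/2)] times the alternating series.  Writing
    [d = (-1)^j q^(j(j+1)/2) S], the zero satisfies
    [S D = alternating polynomial + O(q^N)] with [N = m j + m(m+1)/2]; the terms
    quadratic in [d] and the truncation of [D] are negligible because the
    hypothesis on [j] says exactly that [N <= j(j+1)/2]. *)

Local Open Scope C_scope.

(** * Finite sums and convergent series of complex numbers *)

Definition cseries (a : nat -> C) (l : C) : Prop :=
  @is_series C_AbsRing C_NormedModule a l.

Fixpoint csum (n : nat) (f : nat -> C) : C :=
  match n with O => 0 | S p => csum p f + f p end.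

Lemma csum_ext (n : nat) (f g : nat -> C) :
  (forall i, (i < n)%nat -> f i = g i) -> csum n f = csum n g.
Proof.
  induction n as [|n IH]; intros H; simpl; [reflexivity|].
  rewrite IH, H; auto.
Qed.

Lemma csum_plus (n : nat) (f g : nat -> C) :
  csum n (fun i => f i + g i) = csum n f + csum n g.
Proof. induction n as [|n IH]; simpl; [ring | rewrite IH; ring]. Qed.

Lemma csum_scal (n : nat) (c : C) (f : nat -> C) :
  csum n (fun i => c * f i) = c * csum n f.
Proof. induction n as [|n IH]; simpl; [ring | rewrite IH; ring]. Qed.

Lemma csum_split (n p : nat) (f : nat -> C) :
  csum (n + p) f = csum n f + csum p (fun i => f (n + i)%nat).
Proof.
  induction p as [|p IH]; simpl.
  - rewrite Nat.add_0_r; ring.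
  - rewrite Nat.add_succ_r; simpl; rewrite IH; ring.
Qed.

Lemma csum_head (n : nat) (f : nat -> C) : (1 <= n)%nat ->
  csum n f = f 0%nat + csum (n - 1) (fun i => f (1 + i)%nat).
Proof.
  intros Hn; replace n with (1 + (n - 1))%nat at 1 by lia.
  rewrite csum_split; simpl; ring.
Qed.

Lemma csum_rev (n : nat) (f : nat -> C) :
  csum n f = csum n (fun i => f (n - 1 - i)%nat).
Proof.
  induction n as [|n IH]; [reflexivity|].
  generalize (csum_split 1 n (fun i => f (S n - 1 - i)%nat)); simpl; intros ->.
  rewrite IH, (csum_ext n (fun i => f (n - 0 - S i)%nat) (fun i => f (n - 1 - i)%nat)).
  - replace (n - 0 - 0)%nat with n by lia; ring.
  - intros i Hi; f_equal; lia.
Qed.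

(** Folding about the midpoint matches index [n + i] with its mirror image [n - 1 - i]; with [n = j]
    this is the reflection of the theta exponents. *)
Lemma csum_pair (n : nat) (f : nat -> C) :
  csum (n + n) f = csum n (fun i => f (n + i)%nat + f (n - 1 - i)%nat).
Proof. rewrite csum_split, csum_plus, (csum_rev n f); ring. Qed.

Lemma sum_n_csum (a : nat -> C) (n : nat) :
  @sum_n C_AbelianMonoid a n = csum (S n) a.
Proof.
  induction n as [|n IH].
  - rewrite sum_O; simpl; ring.
  - rewrite sum_Sn, IH; reflexivity.
Qed.

Lemma cseries_ext (a b : nat -> C) (l : C) :
  (forall n, a n = b n) -> cseries a l -> cseries b l.
Proof. apply is_series_ext. Qed.

Lemma cseries_scal (c : C) (a : nat -> C) (l : C) :
  cseries a l -> cseries (fun n => c * a n) (c * l).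
Proof. exact (is_series_scal_l c a l). Qed.

Lemma cseries_plus (a b : nat -> C) (l l' : C) :
  cseries a l -> cseries b l' -> cseries (fun n => a n + b n) (l + l').
Proof. exact (is_series_plus a b l l'). Qed.

Lemma cseries_tail (n : nat) (a : nat -> C) (l : C) :
  cseries a l -> cseries (fun k => a (n + k)%nat) (l - csum n a).
Proof.
  destruct n as [|n]; intros H.
  - simpl; replace (l - 0) with l by ring; exact H.
  - apply is_series_incr_n; [lia|].
    rewrite sum_n_csum; change plus with Cplus; simpl Nat.pred.
    replace (l - csum (S n) a + csum (S n) a) with l by ring; exact H.
Qed.

Lemma cseries_untail (n : nat) (a : nat -> C) (l : C) :
  cseries (fun k => a (n + k)%nat) l -> cseries a (l + csum n a).
Proof.
  destruct n as [|n]; intros H.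
  - simpl; replace (l + 0) with l by ring; exact H.
  - apply (is_series_decr_n a (S n)); [lia|].
    rewrite sum_n_csum; simpl Nat.pred.
    change (cseries (fun k => a (S n + k)%nat) (l + csum (S n) a + - csum (S n) a)).
    replace (l + csum (S n) a + - csum (S n) a) with l by ring; exact H.
Qed.

(** The partial sums stay below [2 * B - 2 * B * (1 / 2) ^ n], and a closed ball contains the limits
    of its sequences. *)
Lemma cseries_geom_bound (a : nat -> C) (l : C) (B : R) :
  cseries a l -> (forall n, (Cmod (a n) <= B * (1 / 2) ^ n)%R) -> (Cmod l <= 2 * B)%R.
Proof.
  intros Ha Hb.
  assert (HB : (0 <= B)%R).
  { generalize (Hb 0%nat) (Cmod_ge_0 (a 0%nat)); simpl; lra. }
  assert (Hs : forall n, (Cmod (csum n a) <= 2 * B - 2 * B * (1 / 2) ^ n)%R).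
  { induction n as [|n IH]; simpl.
    - rewrite Cmod_0; lra.
    - generalize (Cmod_triangle (csum n a) (a n)) (Hb n); lra. }
  assert (Hcl : closed (fun z : C => (Cmod z <= 2 * B)%R)).
  { apply (closed_comp (U := R_UniformSpace) Cmod (fun x => (x <= 2 * B)%R)).
    - intro x; apply (@filterlim_norm C_AbsRing C_NormedModule).
    - apply closed_le. }
  refine (closed_filterlim (sum_n a) _ l Ha _ Hcl).
  intro n; simpl; rewrite sum_n_csum.
  assert (Hp : (0 <= (1 / 2) ^ (S n))%R) by (apply pow_le; lra).
  generalize (Hs (S n)); nra.
Qed.

Lemma cseries_terms_bounded (a : nat -> C) (l : C) :
  cseries a l -> exists M, forall n, (Cmod (a n) <= M)%R.
Proof.
  intros H.
  destruct (filterlim_bounded (sum_n a) (ex_intro _ l H)) as [M HM].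
  assert (HM' : forall n, (Cmod (csum (S n) a) <= M)%R).
  { intro n; rewrite <- sum_n_csum; apply HM. }
  assert (M0 : (0 <= M)%R).
  { generalize (HM' 0%nat) (Cmod_ge_0 (csum 1 a)); lra. }
  exists (2 * M)%R; intros [|n].
  - generalize (HM' 0%nat); simpl; replace (0 + a 0%nat) with (a 0%nat) by ring; lra.
  - replace (a (S n)) with (csum (S (S n)) a + - csum (S n) a) by (simpl; ring).
    generalize (Cmod_triangle (csum (S (S n)) a) (- csum (S n) a)) (HM' n) (HM' (S n)).
    rewrite Cmod_opp; lra.
Qed.

(** * Orders of vanishing at the origin *)

(* [f(q) = O(q^N)] as [q] tends to [0] with [q <> 0] *)
Definition bigO (N : nat) (f : C -> C) : Prop :=
  exists K rho : R, (0 < rho)%R /\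
    forall q, (0 < Cmod q < rho)%R -> (Cmod (f q) <= K * Cmod q ^ N)%R.

Definition near0 (P : C -> Prop) : Prop :=
  exists rho : R, (0 < rho)%R /\ forall q, (0 < Cmod q < rho)%R -> P q.

Lemma near0_lt (r : R) : (0 < r)%R -> near0 (fun q => (0 < Cmod q < r)%R).
Proof. intros Hr; exists r; auto. Qed.

Lemma near0_and (P Q : C -> Prop) :
  near0 P -> near0 Q -> near0 (fun q => P q /\ Q q).
Proof.
  intros [r [Hr HP]] [s [Hs HQ]].
  exists (Rmin r s); split; [apply Rmin_glb_lt; assumption|].
  intros q Hq; generalize (Rmin_l r s) (Rmin_r r s); intros.
  split; [apply HP | apply HQ]; lra.
Qed.

Lemma near0_imp (P Q : C -> Prop) :
  (forall q, P q -> Q q) -> near0 P -> near0 Q.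
Proof. intros H [r [Hr HP]]; exists r; auto. Qed.

(** Normal form for the proofs below: with [K] nonnegative and [|q| < 1], bounds may be multiplied
    and powers of [|q|] decrease with the exponent. *)
Lemma bigO_near0 (N : nat) (f : C -> C) :
  bigO N f <->
  exists K, (0 <= K)%R /\
    near0 (fun q => (0 < Cmod q < 1)%R /\ (Cmod (f q) <= K * Cmod q ^ N)%R).
Proof.
  split.
  - intros [K [r [Hr H]]]; exists (Rabs K); split; [apply Rabs_pos|].
    apply near0_and; [apply near0_lt; lra|].
    exists r; split; [exact Hr|]; intros q Hq.
    apply Rle_trans with (1 := H q Hq).
    apply Rmult_le_compat_r; [apply pow_le; lra | apply Rle_abs].
  - intros [K [_ [r [Hr H]]]]; exists K, r; split; [exact Hr|].
    intros q Hq; apply H, Hq.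
Qed.

Lemma bigO_ext (N : nat) (f g : C -> C) :
  near0 (fun q => f q = g q) -> bigO N f -> bigO N g.
Proof.
  rewrite !bigO_near0; intros He [K [HK H]]; exists K; split; [exact HK|].
  generalize (near0_and _ _ He H); apply near0_imp.
  intros q [<- ?]; assumption.
Qed.

Lemma bigO_le (N M : nat) (f : C -> C) : (M <= N)%nat -> bigO N f -> bigO M f.
Proof.
  rewrite !bigO_near0; intros Hle [K [HK H]]; exists K; split; [exact HK|].
  revert H; apply near0_imp; intros q [H1 H2]; split; [exact H1|].
  apply Rle_trans with (1 := H2); apply Rmult_le_compat_l; [exact HK|].
  replace N with (M + (N - M))%nat by lia; rewrite pow_add.
  rewrite <- (Rmult_1_r (Cmod q ^ M)) at 2.
  apply Rmult_le_compat_l; [apply pow_le; lra|].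
  rewrite <- (pow1 (N - M)); apply pow_incr; lra.
Qed.

Lemma bigO_plus (N : nat) (f g : C -> C) :
  bigO N f -> bigO N g -> bigO N (fun q => f q + g q).
Proof.
  rewrite !bigO_near0; intros [K [HK Hf]] [L [HL Hg]].
  exists (K + L)%R; split; [lra|].
  generalize (near0_and _ _ Hf Hg); apply near0_imp.
  intros q [[H1 H2] [_ H3]]; split; [exact H1|].
  generalize (Cmod_triangle (f q) (g q)); lra.
Qed.

Lemma bigO_mult (N M : nat) (f g : C -> C) :
  bigO N f -> bigO M g -> bigO (N + M) (fun q => f q * g q).
Proof.
  rewrite !bigO_near0; intros [K [HK Hf]] [L [HL Hg]].
  exists (K * L)%R; split; [apply Rmult_le_pos; assumption|].
  generalize (near0_and _ _ Hf Hg); apply near0_imp.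
  intros q [[H1 H2] [_ H3]]; split; [exact H1|].
  rewrite Cmod_mult, pow_add.
  replace (K * L * (Cmod q ^ N * Cmod q ^ M))%R
    with ((K * Cmod q ^ N) * (L * Cmod q ^ M))%R by ring.
  apply Rmult_le_compat; auto using Cmod_ge_0.
Qed.

Lemma bigO_const (c : C) : bigO 0 (fun _ => c).
Proof.
  exists (Cmod c), 1%R; split; [lra|]; intros; simpl; lra.
Qed.

Lemma bigO_pow (N : nat) : bigO N (fun q => q ^ N).
Proof.
  exists 1%R, 1%R; split; [lra|]; intros; rewrite Cmod_pow; lra.
Qed.

Lemma bigO_scal (N : nat) (c : C) (f : C -> C) :
  bigO N f -> bigO N (fun q => c * f q).
Proof. exact (bigO_mult 0 N (fun _ => c) f (bigO_const c)). Qed.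

Lemma bigO_minus (N : nat) (f g : C -> C) :
  bigO N f -> bigO N g -> bigO N (fun q => f q - g q).
Proof.
  intros Hf Hg.
  apply (bigO_ext N (fun q => f q + (- (1)) * g q)).
  - exists 1%R; split; [lra|]; intros; ring.
  - apply bigO_plus, bigO_scal; assumption.
Qed.

Lemma bigO_csum (N n : nat) (f : nat -> C -> C) :
  (forall i, (i < n)%nat -> bigO N (f i)) -> bigO N (fun q => csum n (fun i => f i q)).
Proof.
  induction n as [|n IH]; intros H; simpl.
  - exists 0%R, 1%R; split; [lra|]; intros; rewrite Cmod_0; lra.
  - apply bigO_plus; auto.
Qed.

Lemma bigO_div (n N : nat) (f : C -> C) :
  bigO (n + N) (fun q => q ^ n * f q) -> bigO N f.
Proof.
  intros [K [r [Hr H]]]; exists K, r; split; [exact Hr|]; intros q Hq.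
  generalize (H q Hq); rewrite Cmod_mult, Cmod_pow, pow_add; intros H1.
  apply Rmult_le_reg_l with (Cmod q ^ n)%R; [apply pow_lt; lra | lra].
Qed.

Lemma bigO_1_const (c : C) : bigO 1 (fun _ => c) -> c = 0.
Proof.
  rewrite bigO_near0; intros [K [HK [r [Hr H]]]].
  destruct (Ceq_dec c 0) as [|Hc]; [assumption|exfalso].
  assert (Hm : (0 < Cmod c)%R) by (apply Cmod_gt_0; exact Hc).
  (* At the real point [t] of the punctured disc the hypothesis gives [|c| <= K t], while the second
     bound on [t] gives [K t < |c|]. *)
  set (t := Rmin (r / 2) (Cmod c / (2 * (K + 1)))).
  assert (Ht : (0 < t)%R).
  { apply Rmin_glb_lt; [lra|]; apply Rdiv_lt_0_compat; lra. }
  assert (Ht1 : (t <= r / 2)%R) by apply Rmin_l.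
  assert (Ht2 : (t * (2 * (K + 1)) <= Cmod c)%R).
  { apply Rle_trans with (Cmod c / (2 * (K + 1)) * (2 * (K + 1)))%R.
    - apply Rmult_le_compat_r; [lra | apply Rmin_r].
    - right; field; lra. }
  assert (Hq : Cmod (RtoC t) = t) by (rewrite Cmod_R; apply Rabs_pos_eq; lra).
  destruct (H (RtoC t)) as [_ H1]; [rewrite Hq; lra|].
  rewrite Hq in H1; simpl in H1; nra.
Qed.

(** * Power series expansions near the origin *)

Definition expands (a : nat -> C) (f : C -> C) : Prop :=
  near0 (fun q => cseries (fun n => a n * q ^ n) (f q)).

(** Convergence at the single point [t = r / 2] bounds the terms [a n * t ^ n]; for [|q| < t / 2]
    the series is then dominated by a geometric one of ratio 1/2. *)
Lemma expands_bounded (a : nat -> C) (f : C -> C) : expands a f -> bigO 0 f.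
Proof.
  intros [r [Hr H]].
  set (t := (r / 2)%R).
  assert (Ht : Cmod (RtoC t) = t) by (rewrite Cmod_R; apply Rabs_pos_eq; unfold t; lra).
  destruct (cseries_terms_bounded _ _ (H (RtoC t) ltac:(rewrite Ht; unfold t; lra))) as [M HM].
  exists (2 * M)%R, (t / 2)%R; split; [unfold t; lra|].
  intros q Hq; simpl; rewrite Rmult_1_r.
  apply (cseries_geom_bound (fun n => a n * q ^ n)); [apply H; unfold t in Hq; lra|].
  intro n; specialize (HM n); rewrite Cmod_mult, Cmod_pow in *; rewrite Ht in HM.
  apply Rle_trans with (Cmod (a n) * t ^ n * (1 / 2) ^ n)%R.
  - rewrite Rmult_assoc, <- Rpow_mult_distr.
    apply Rmult_le_compat_l; [apply Cmod_ge_0|].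
    apply pow_incr; lra.
  - apply Rmult_le_compat_r; [apply pow_le; lra | exact HM].
Qed.

Lemma expands_quotient (a : nat -> C) (f : C -> C) :
  expands a f -> expands (fun n => a (S n)) (fun q => (f q - a 0%nat) / q).
Proof.
  intros [r [Hr H]]; exists r; split; [exact Hr|]; intros q Hq.
  assert (Hq0 : q <> 0) by (apply Cmod_gt_0; lra).
  generalize (cseries_scal (/ q) _ _ (cseries_tail 1 _ _ (H q Hq))); intros H1.
  replace ((f q - a 0%nat) / q) with (/ q * (f q - csum 1 (fun n => a n * q ^ n)))
    by (simpl; field; exact Hq0).
  revert H1; apply cseries_ext; intro n; simpl; field; exact Hq0.
Qed.

(** Induction on [N]: the constant coefficient is O(q), hence zero, and division by [q] lowers both
    the series and the order by one. This is the tool for comparing coefficients in the main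
    proof. *)
Lemma expands_vanish (N : nat) (a : nat -> C) (f : C -> C) :
  expands a f -> bigO N f -> forall k, (k < N)%nat -> a k = 0.
Proof.
  revert a f; induction N as [|N IH]; intros a f Ha Hf k Hk; [lia|].
  assert (Hb := expands_quotient a f Ha).
  assert (H0 : a 0%nat = 0).
  { apply bigO_1_const.
    (* The constant is written as a difference of two O(q) functions: [f] itself and [q] times the
       bounded quotient. *)
    apply (bigO_ext 1 (fun q => f q - q ^ 1 * ((f q - a 0%nat) / q))).
    - apply near0_imp with (2 := near0_lt 1 Rlt_0_1); intros q Hq.
      field; apply Cmod_gt_0; lra.
    - apply bigO_minus.
      + apply bigO_le with (2 := Hf); lia.
      + apply (bigO_mult 1 0 (fun q => q ^ 1)); [apply bigO_pow|].
        exact (expands_bounded _ _ Hb). }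
  destruct k as [|k]; [exact H0|].
  apply (IH (fun n => a (S n)) (fun q => (f q - a 0%nat) / q) Hb); [|lia].
  apply (bigO_div 1 N).
  apply bigO_ext with (2 := Hf).
  apply near0_imp with (2 := near0_lt 1 Rlt_0_1); intros q Hq.
  rewrite H0; field; apply Cmod_gt_0; lra.
Qed.

Lemma expands_plus (a b : nat -> C) (f g : C -> C) :
  expands a f -> expands b g -> expands (fun n => a n + b n) (fun q => f q + g q).
Proof.
  intros Ha Hb; generalize (near0_and _ _ Ha Hb); apply near0_imp; intros q [H1 H2].
  generalize (cseries_plus _ _ _ _ H1 H2); apply cseries_ext; intro n; ring.
Qed.

Lemma expands_scal (c : C) (a : nat -> C) (f : C -> C) :
  expands a f -> expands (fun n => c * a n) (fun q => c * f q).
Proof.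
  apply near0_imp; intros q H.
  generalize (cseries_scal c _ _ H); apply cseries_ext; intro n; ring.
Qed.

Lemma expands_0 : expands (fun _ => 0) (fun _ => 0).
Proof.
  exists 1%R; split; [lra|]; intros q _.
  apply cseries_ext with (fun _ => 0); [intro; ring|].
  apply filterlim_ext with (fun _ => RtoC 0).
  - intro n; rewrite sum_n_csum; induction n as [|n IH]; simpl in *; [ring|].
    rewrite <- IH; ring.
  - apply filterlim_const.
Qed.

Lemma expands_shift (n : nat) (a : nat -> C) (f : C -> C) :
  expands a f ->
  expands (fun k => if Nat.leb n k then a (k - n)%nat else 0) (fun q => q ^ n * f q).
Proof.
  apply near0_imp; intros q H.
  set (b := fun k => (if Nat.leb n k then a (k - n)%nat else 0) * q ^ k).
  assert (H0 : csum n b = 0).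
  { rewrite (csum_ext n b (fun _ => 0 * 0)).
    - rewrite csum_scal; ring.
    - intros i Hi; unfold b; rewrite (proj2 (Nat.leb_gt n i) Hi); ring. }
  replace (q ^ n * f q) with (q ^ n * f q + csum n b) by (rewrite H0; ring).
  apply cseries_untail.
  generalize (cseries_scal (q ^ n) _ _ H); apply cseries_ext; intro k; unfold b.
  rewrite (proj2 (Nat.leb_le n (n + k))) by lia.
  replace (n + k - n)%nat with k by lia; rewrite Cpow_add_r; ring.
Qed.

Lemma expands_csum (n : nat) (a : nat -> nat -> C) (f : nat -> C -> C) :
  (forall i, (i < n)%nat -> expands (a i) (f i)) ->
  expands (fun k => csum n (fun i => a i k)) (fun q => csum n (fun i => f i q)).
Proof.
  induction n as [|n IH]; intros H; simpl; [apply expands_0|].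
  apply expands_plus; auto.
Qed.

Lemma expands_1 : expands (fun k => if Nat.eqb k 0 then 1 else 0) (fun _ => 1).
Proof.
  destruct expands_0 as [r [Hr H]]; exists r; split; [exact Hr|]; intros q Hq.
  generalize (cseries_untail 1 (fun k => (if Nat.eqb k 0 then 1 else 0) * q ^ k) 0).
  replace (0 + csum 1 (fun k => (if Nat.eqb k 0 then 1 else 0) * q ^ k)) with (RtoC 1)
    by (simpl; ring).
  intros Hu; apply Hu.
  generalize (H q Hq); apply cseries_ext; intro n; simpl; ring.
Qed.

Lemma expands_pow (n : nat) : expands (fun k => if Nat.eqb n k then 1 else 0) (fun q => q ^ n).
Proof.
  generalize (expands_shift n _ _ expands_1); apply near0_imp; intros q H.
  replace (q ^ n * 1) with (q ^ n) in H by ring.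
  revert H; apply cseries_ext; intro k.
  destruct (Nat.leb_spec n k), (Nat.eqb_spec n k), (Nat.eqb_spec (k - n) 0);
    try reflexivity; lia.
Qed.

(** * Triangular numbers and the reflection of exponents *)

Lemma tri_double (n : nat) : (2 * tri n = n * (n + 1))%nat.
Proof.
  unfold tri.
  assert (H := Nat.div_mod_eq (n * (n + 1)) 2).
  destruct (Nat.Even_or_Odd n) as [[p Hp]|[p Hp]].
  - replace (n * (n + 1))%nat with ((p * (n + 1)) * 2)%nat by (rewrite Hp at 2; ring).
    rewrite Nat.div_mul; lia.
  - replace (n * (n + 1))%nat with ((n * (p + 1)) * 2)%nat by (rewrite Hp; ring).
    rewrite Nat.div_mul; lia.
Qed.

(* [(i - j)(i - j + 1) / 2], an integer that is invariant under [i -> 2j - 1 - i]. *)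
Definition shifted_tri (j i : nat) : nat :=
  if Nat.leb j i then tri (i - j) else tri (j - 1 - i).

(** Expanding [(i-j)(i-j+1)/2] gives [i(i+1)/2 - ij + j(j-1)/2]; the additive form avoids truncated
    subtraction. It explains the factor [q^(j(j-1)/2)] put in front of theta. *)
Lemma shifted_tri_eq (j i : nat) : (1 <= j)%nat ->
  (tri i + j * (j - 1) / 2 = shifted_tri j i + i * j)%nat.
Proof.
  intros Hj; unfold shifted_tri.
  assert (E : (j * (j - 1) / 2 = tri (j - 1))%nat).
  { unfold tri; f_equal; replace (j - 1 + 1)%nat with j by lia; ring. }
  rewrite E.
  assert (H1 := tri_double i); assert (H2 := tri_double (j - 1)).
  destruct (Nat.leb_spec j i).
  - assert (H3 := tri_double (i - j)).
    replace i with (j + (i - j))%nat in * by lia.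
    replace j with (1 + (j - 1))%nat in * by lia.
    set (a := (i - j)%nat) in *; set (b := (j - 1)%nat) in *.
    replace (1 + b + a - (1 + b))%nat with a in * by lia.
    replace (1 + b - 1)%nat with b in * by lia.
    nia.
  - assert (H3 := tri_double (j - 1 - i)).
    set (a := (j - 1 - i)%nat) in *.
    replace (j - 1)%nat with (a + i)%nat in * by lia.
    replace j with (1 + a + i)%nat by lia.
    nia.
Qed.

Lemma shifted_tri_ge (j i : nat) : shifted_tri j (j + i) = tri i.
Proof.
  unfold shifted_tri; rewrite (proj2 (Nat.leb_le j (j + i))) by lia.
  f_equal; lia.
Qed.

Lemma shifted_tri_lt (j i : nat) : (i < j)%nat -> shifted_tri j (j - 1 - i) = tri i.
Proof.
  intros Hi; unfold shifted_tri.
  rewrite (proj2 (Nat.leb_gt j (j - 1 - i))) by lia.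
  f_equal; lia.
Qed.

(** For [m = j] and [n = m] this splits the exponent of the first discarded theta term into [tri j]
    plus the target order. *)
Lemma tri_add (m n : nat) : (tri (m + n) = tri m + n * m + tri n)%nat.
Proof.
  generalize (tri_double m) (tri_double n) (tri_double (m + n)); nia.
Qed.

Lemma tri_ge (n : nat) : (n <= tri n)%nat.
Proof. generalize (tri_double n); nia. Qed.

Lemma sign_even (n : nat) : (- (1)) ^ (2 * n) = 1.
Proof.
  rewrite Cpow_mult_r; replace ((- (1)) ^ 2) with (RtoC 1) by ring.
  apply Cpow_1_l.
Qed.

Lemma sign_reflect (j i : nat) : (i < j)%nat ->
  (- (1)) ^ (j - 1 - i) = - (- (1)) ^ (j + i).
Proof.
  intros Hi; replace (j + i)%nat with (j - 1 - i + (1 + 2 * i))%nat by lia.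
  rewrite !Cpow_add_r, sign_even; ring.
Qed.

(** * The theta equation at a zero, to first order *)

Definition theta_term (j : nat) (q d : C) (i : nat) : C :=
  (- (1)) ^ i * q ^ shifted_tri j i * (1 - d) ^ i.

(* [q^(j(j-1)/2) theta(q, x)] for [x = - q^(-j) (1 - d)] *)
Lemma theta_rescale (j : nat) (q d x : C) : (1 <= j)%nat -> q <> 0 ->
  x = - / q ^ j * (1 - d) -> is_theta q x 0 -> cseries (theta_term j q d) 0.
Proof.
  intros Hj Hq -> H.
  replace (RtoC 0) with (q ^ (j * (j - 1) / 2) * 0) by ring.
  generalize (cseries_scal (q ^ (j * (j - 1) / 2)) _ _ H).
  apply cseries_ext; intro i; unfold theta_term.
  assert (Hn := Cpow_nz q (i * j) Hq).
  replace (q ^ shifted_tri j i) with (q ^ tri i * q ^ (j * (j - 1) / 2) / q ^ (i * j)).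
  - replace (- / q ^ j * (1 - d)) with ((- (1)) * (1 - d) * / q ^ j) by ring.
    rewrite !Cpow_mult_l, Cpow_inv by (apply Cpow_nz; exact Hq).
    rewrite <- Cpow_mult_r, (Nat.mul_comm j i).
    field; exact Hn.
  - rewrite <- Cpow_add_r, (shifted_tri_eq j i Hj), Cpow_add_r; field; exact Hn.
Qed.

(** The first omitted term, at [i = j + M], carries [q ^ tri M], and the later ones decay
    geometrically. *)
Lemma theta_truncation (j M : nat) (d : C -> C) :
  near0 (fun q => cseries (theta_term j q (d q)) 0) ->
  near0 (fun q => (Cmod (d q) <= 1)%R) ->
  bigO (tri M) (fun q => csum (j + M) (theta_term j q (d q))).
Proof.
  intros H1 H2.
  (* Each further term brings a factor [1 - d] of modulus at most 2 and at least one more [q];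
     [|q| < 1/4] makes the ratio at most 1/2. *)
  assert (H3 := near0_lt (1 / 4) ltac:(lra)).
  destruct (near0_and _ _ (near0_and _ _ H1 H2) H3) as [r [Hr H]].
  (* The first 2 is the sum of the geometric series; [2 ^ (j + M)] bounds the initial power of
     [1 - d]. *)
  exists (2 * 2 ^ (j + M))%R, r; split; [exact Hr|]; intros q Hq.
  destruct (H q Hq) as [[Hs Hd] Hq4].
  assert (Ht := cseries_tail (j + M) _ _ Hs).
  rewrite <- Cmod_opp.
  replace (- csum (j + M) (theta_term j q (d q)))
    with (0 - csum (j + M) (theta_term j q (d q))) by ring.
  rewrite Rmult_assoc.
  apply (cseries_geom_bound _ _ _ Ht); intro n.
  unfold theta_term.
  replace (j + M + n)%nat with (j + (M + n))%nat by lia; rewrite shifted_tri_ge.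
  rewrite !Cmod_mult, !Cmod_pow, Cmod_opp, Cmod_1, pow1, Rmult_1_l.
  assert (H1d : (0 <= Cmod (1 - d q) <= 2)%R).
  { split; [apply Cmod_ge_0|].
    generalize (Cmod_triangle 1 (- d q)); rewrite Cmod_opp, Cmod_1.
    unfold Cminus; lra. }
  replace (2 ^ (j + M) * Cmod q ^ tri M * (1 / 2) ^ n)%R
    with (Cmod q ^ tri M * (1 / 4) ^ n * 2 ^ (j + (M + n)))%R.
  2: { rewrite Nat.add_assoc, (pow_add 2 (j + M) n).
       replace (1 / 2)%R with (1 / 4 * 2)%R by field.
       rewrite Rpow_mult_distr; ring. }
  apply Rmult_le_compat; try (apply pow_le; lra).
  - replace (tri (M + n)) with (tri M + n + (n * M + tri n - n))%nat
      by (generalize (tri_add M n) (tri_ge n); lia).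
    rewrite !pow_add.
    rewrite <- (Rmult_1_r (Cmod q ^ tri M * (1 / 4) ^ n)).
    apply Rmult_le_compat; try (repeat apply Rmult_le_pos; apply pow_le; lra).
    + apply Rmult_le_compat_l; [apply pow_le; lra | apply pow_incr; lra].
    + rewrite <- (pow1 (n * M + tri n - n)); apply pow_incr; lra.
  - apply pow_incr; exact H1d.
Qed.

Lemma bigO_near_small (N : nat) (f : C -> C) :
  (1 <= N)%nat -> bigO N f -> near0 (fun q => (Cmod (f q) <= 1)%R).
Proof.
  intros HN H; apply (bigO_le N 1) in H; [|exact HN].
  apply bigO_near0 in H; destruct H as [K [HK H]].
  assert (H2 := near0_lt (/ (K + 1)) ltac:(apply Rinv_0_lt_compat; lra)).
  generalize (near0_and _ _ H H2); apply near0_imp.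
  intros q [[_ H3] [_ H4]]; simpl in H3.
  apply (Rmult_lt_compat_l (K + 1)) in H4; [|lra].
  rewrite Rinv_r in H4 by lra.
  generalize (Cmod_ge_0 q); nra.
Qed.

Lemma bigO_binomial (T i : nat) (d : C -> C) : bigO T d ->
  bigO (T + T) (fun q => (1 - d q) ^ i - (1 - INR i * d q)).
Proof.
  intros Hd; induction i as [|i IH].
  - apply bigO_ext with (fun _ => 0); [|exists 0%R, 1%R; split; [lra|]; intros; rewrite Cmod_0; lra].
    exists 1%R; split; [lra|]; intros; simpl; ring.
  (* Uses [(1 - d)(1 - i d) = 1 - (i + 1) d + i d^2]. *)
  - apply bigO_ext with
      (fun q => (1 - d q) * ((1 - d q) ^ i - (1 - INR i * d q)) + INR i * (d q * d q)).
    + exists 1%R; split; [lra|]; intros; rewrite S_INR, RtoC_plus, Cpow_S; ring.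
    + apply bigO_plus.
      * apply (bigO_mult 0 (T + T) (fun q => 1 - d q)); [|exact IH].
        apply bigO_minus; [apply bigO_const|].
        apply bigO_le with (2 := Hd); lia.
      * apply bigO_scal, bigO_mult; exact Hd.
Qed.

(** The coefficients in Jacobi's identity for the cube of the Euler product, where [jacobi_coeff v]
    belongs to [q^(v(v+1)/2)]. *)
Definition jacobi_coeff (v : nat) : C := (- (1)) ^ v * (2 * INR v + 1).

(* [d/dx] of the theta series at [x = - q^(-j)], up to a monomial factor and an
   error [O(q^(j(j+1)/2))]. *)
Definition theta_slope (j : nat) (q : C) : C :=
  csum j (fun v => jacobi_coeff v * q ^ tri v).

Definition alt_poly (m j : nat) (q : C) : C :=
  csum m (fun s => (- (1)) ^ s * q ^ (s * j + tri s)).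

(** The indices [j + v] and [j - 1 - v] share the exponent [tri v] and have opposite signs, so the
    constants cancel; the difference of the two indices is the Jacobi factor [2v + 1]. *)
Lemma linear_pairing (j : nat) (q d : C) :
  csum (j + j) (fun i => (- (1)) ^ i * q ^ shifted_tri j i * (1 - INR i * d))
  = - ((- (1)) ^ j * d * theta_slope j q).
Proof.
  unfold theta_slope.
  replace (- ((- (1)) ^ j * d * csum j (fun v => jacobi_coeff v * q ^ tri v)))
    with (- ((- (1)) ^ j * d) * csum j (fun v => jacobi_coeff v * q ^ tri v)) by ring.
  rewrite csum_pair, <- csum_scal; apply csum_ext; intros v Hv; unfold jacobi_coeff.
  rewrite shifted_tri_ge, shifted_tri_lt, sign_reflect, Cpow_add_r by exact Hv.
  replace (j - 1 - v)%nat with (j - S v)%nat by lia.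
  rewrite minus_INR, S_INR, plus_INR by lia.
  rewrite RtoC_minus, !RtoC_plus; ring.
Qed.

(* All contributions quadratic in [d] are [O(q^(2 tri j))], which the second
   hypothesis makes negligible. *)
Lemma theta_zero_first_order (m j : nat) (S : C -> C) :
  (1 <= j)%nat -> (m * j + tri m <= tri j)%nat ->
  near0 (fun q => cseries (theta_term j q ((- (1)) ^ j * q ^ tri j * S q)) 0) ->
  bigO 0 S ->
  bigO (m * j + tri m) (fun q => S q * theta_slope j q - alt_poly m j q).
Proof.
  intros Hj HN Hz HS.
  set (T := tri j) in *.
  set (d := fun q => (- (1)) ^ j * q ^ T * S q) in *.
  assert (HT : (1 <= T)%nat) by (generalize (tri_ge j); unfold T; lia).
  assert (Hd : bigO T d).
  { replace T with (T + 0)%nat by lia; apply bigO_mult; [|exact HS].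
    apply bigO_scal, bigO_pow. }
  (* The cut after [2j + m] terms is chosen because [tri (j + m)] equals [T + N], the order needed
     before dividing by [q ^ T]. *)
  assert (Hh := theta_truncation j (j + m) d Hz (bigO_near_small T d HT Hd)).
  replace (tri (j + m)) with (T + (m * j + tri m))%nat in Hh
    by (rewrite tri_add; unfold T; lia).
  set (N := (m * j + tri m)%nat) in *.
  assert (H2T : forall f, bigO (T + T) f -> bigO (T + N) f).
  { intros f; apply bigO_le; lia. }
  assert (Hlin : forall i, bigO (T + N) (fun q =>
    (- (1)) ^ i * q ^ shifted_tri j i * ((1 - d q) ^ i - (1 - INR i * d q)))).
  { intro i; apply H2T.
    apply (bigO_mult 0 (T + T) (fun q => (- (1)) ^ i * q ^ shifted_tri j i)).
    - apply bigO_scal; apply bigO_le with (2 := bigO_pow (shifted_tri j i)); lia.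
    - apply bigO_binomial; exact Hd. }
  (* Beyond index [2j] even the linear terms are negligible: the exponent [tri (j + s)] is at least
     [T], and [d] supplies another [T]. *)
  assert (Hs : forall s, bigO (T + N) (fun q =>
    (- (1)) ^ (j + (j + s)) * q ^ shifted_tri j (j + (j + s)) * (INR (j + (j + s)) * d q))).
  { intro s; apply H2T.
    apply bigO_mult; [|apply bigO_scal; exact Hd].
    apply bigO_scal; apply bigO_le with (2 := bigO_pow _).
    rewrite shifted_tri_ge, tri_add; unfold T; lia. }
  apply (bigO_div T N).
  (* Binomial remainders below and above [2j], minus the late linear terms, minus the truncated
     theta sum: what survives is [q ^ T * (S q * theta_slope j q - alt_poly m j q)]. *)
  apply bigO_ext with (fun q =>
    csum (j + j) (fun i => (- (1)) ^ i * q ^ shifted_tri j i * ((1 - d q) ^ i - (1 - INR i * d q)))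
    + csum m (fun s => (- (1)) ^ (j + (j + s)) * q ^ shifted_tri j (j + (j + s))
        * ((1 - d q) ^ (j + (j + s)) - (1 - INR (j + (j + s)) * d q)))
    - csum m (fun s => (- (1)) ^ (j + (j + s)) * q ^ shifted_tri j (j + (j + s))
        * (INR (j + (j + s)) * d q))
    - csum (j + (j + m)) (theta_term j q (d q))).
  2: { apply bigO_minus; [|exact Hh]; apply bigO_minus; [apply bigO_plus|];
       apply bigO_csum; intros i _; [apply Hlin | apply Hlin | apply Hs]. }
  exists 1%R; split; [lra|]; intros q _.
  replace (j + (j + m))%nat with (j + j + m)%nat by lia; rewrite (csum_split (j + j) m).
  assert (E1 : csum (j + j) (theta_term j q (d q)) =
    csum (j + j) (fun i => (- (1)) ^ i * q ^ shifted_tri j i * ((1 - d q) ^ i - (1 - INR i * d q)))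
    - (- (1)) ^ j * d q * theta_slope j q).
  { unfold Cminus; rewrite <- linear_pairing, <- csum_plus.
    apply csum_ext; intros i _; unfold theta_term, Cminus; ring. }
  assert (E2 : csum m (fun s => theta_term j q (d q) (j + j + s)) =
    csum m (fun s => (- (1)) ^ (j + (j + s)) * q ^ shifted_tri j (j + (j + s))
        * ((1 - d q) ^ (j + (j + s)) - (1 - INR (j + (j + s)) * d q)))
    + (- (1)) * csum m (fun s => (- (1)) ^ (j + (j + s)) * q ^ shifted_tri j (j + (j + s))
        * (INR (j + (j + s)) * d q))
    + q ^ T * alt_poly m j q).
  { unfold alt_poly; rewrite <- !csum_scal, <- !csum_plus.
    apply csum_ext; intros s _; unfold theta_term.
    replace (j + j + s)%nat with (j + (j + s))%nat by lia.
    rewrite (shifted_tri_ge j (j + s)), tri_add.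
    replace ((- (1)) ^ (j + (j + s))) with ((- (1)) ^ s).
    - rewrite <- Nat.add_assoc, (Cpow_add_r q (tri j)); fold T; ring.
    - replace (j + (j + s))%nat with (2 * j + s)%nat by lia.
      rewrite Cpow_add_r, sign_even; ring. }
  rewrite E1, E2.
  assert (E3 : (- (1)) ^ j * d q = q ^ T * S q).
  { unfold d.
    replace ((- (1)) ^ j * ((- (1)) ^ j * q ^ T * S q))
      with ((- (1)) ^ j * (- (1)) ^ j * (q ^ T * S q)) by ring.
    rewrite <- Cpow_add_r; replace (j + j)%nat with (2 * j)%nat by lia.
    rewrite sign_even; ring. }
  rewrite E3; ring.
Qed.

(** * The recurrence for [r] and uniqueness of the coefficients *)

Lemma csum_exchange (n p : nat) (f : nat -> nat -> C) :
  csum n (fun i => csum p (f i)) = csum p (fun l => csum n (fun i => f i l)).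
Proof.
  induction n as [|n IH]; simpl.
  - rewrite (csum_ext p _ (fun _ => 0 * 0)) by (intros; ring).
    rewrite csum_scal; ring.
  - rewrite IH, csum_plus; reflexivity.
Qed.

Lemma csum_extend (n p : nat) (f : nat -> C) :
  (n <= p)%nat -> (forall i, (n <= i)%nat -> f i = 0) -> csum p f = csum n f.
Proof.
  intros Hle H; replace p with (n + (p - n))%nat by lia.
  rewrite csum_split, (csum_ext (p - n) _ (fun _ => 0 * 0)).
  - rewrite csum_scal; ring.
  - intros i _; rewrite H by lia; ring.
Qed.

Lemma csum_zero (n : nat) (f : nat -> C) :
  (forall i, (i < n)%nat -> f i = 0) -> csum n f = 0.
Proof.
  intros H; rewrite (csum_ext n f (fun _ => 0 * 0)).
  - rewrite csum_scal; ring.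
  - intros i Hi; rewrite H by exact Hi; ring.
Qed.

Lemma csum_single (n p : nat) (f : nat -> C) :
  (p < n)%nat -> (forall i, i <> p -> f i = 0) -> csum n f = f p.
Proof.
  intros Hp H; rewrite (csum_extend (S p) n) by (intros; try apply H; lia).
  simpl; rewrite csum_zero; [ring|].
  intros i Hi; apply H; lia.
Qed.

Lemma RtoC_Zsum (a n : nat) (f : nat -> Z) :
  RtoC (IZR (Zsum a n f)) = csum n (fun i => RtoC (IZR (f (a + i)%nat))).
Proof.
  induction n as [|n IH]; [reflexivity|].
  simpl csum; rewrite <- IH, <- RtoC_plus, <- plus_IZR; do 2 f_equal.
  unfold Zsum; rewrite seq_S, map_app, fold_right_app; simpl.
  generalize (map f (seq a n)); intros l.
  induction l as [|x l IHl]; simpl; [lia | rewrite IHl; lia].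
Qed.

Lemma RtoC_sign (n : nat) : RtoC (IZR ((-1) ^ Z.of_nat n)) = (- (1)) ^ n.
Proof. rewrite <- pow_IZR, RtoC_pow, <- RtoC_opp; reflexivity. Qed.

Lemma tri_le (n p : nat) : (n <= p)%nat -> (tri n <= tri p)%nat.
Proof. generalize (tri_double n) (tri_double p); nia. Qed.

Definition r_val (r : Z -> Z) (z : Z) : C := RtoC (IZR (r z)).

Lemma r_val_neg (r : Z -> Z) (z : Z) : is_r r -> (z < 0)%Z -> r_val r z = 0.
Proof. intros hr Hz; unfold r_val; rewrite (proj1 (proj2 hr)) by exact Hz; reflexivity. Qed.

(** The recurrence for [r] says that its generating series times Jacobi's series is 1. Truncation at
    [n] is harmless since [r] vanishes at negative indices. *)
Lemma r_inverse (r : Z -> Z) (n : nat) (z : Z) : is_r r -> (z < Z.of_nat (tri n))%Z ->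
  csum n (fun v => jacobi_coeff v * r_val r (z - Z.of_nat (tri v)))
  = if Z.eqb z 0 then 1 else 0.
Proof.
  intros hr Hz.
  destruct (Z.lt_ge_cases z 0) as [Hneg|Hpos].
  - rewrite (proj2 (Z.eqb_neq z 0)) by lia.
    apply csum_zero; intros i _; rewrite r_val_neg by (exact hr || lia); ring.
  - assert (Hext : forall p, (z < Z.of_nat (tri p))%Z ->
      forall i, (p <= i)%nat -> jacobi_coeff i * r_val r (z - Z.of_nat (tri i)) = 0).
    { intros p Hp i Hi; rewrite r_val_neg; [ring | exact hr |].
      generalize (tri_le p i Hi); lia. }
    (* This length leaves the term [v = 0] followed by exactly the [z] terms of the recurrence. *)
    set (p := (S (Z.to_nat z))).
    assert (Hp : (z < Z.of_nat (tri p))%Z).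
    { generalize (tri_ge p); unfold p; lia. }
    replace (csum n _) with
      (csum p (fun v => jacobi_coeff v * r_val r (z - Z.of_nat (tri v)))).
    2: { destruct (Nat.le_ge_cases n p).
         - apply csum_extend; [assumption | exact (Hext n Hz)].
         - symmetry; apply csum_extend; [assumption | exact (Hext p Hp)]. }
    unfold p; change (S (Z.to_nat z)) with (1 + Z.to_nat z)%nat; rewrite csum_split.
    destruct (Z.eqb_spec z 0) as [->|Hnz].
    + unfold jacobi_coeff, r_val; simpl; rewrite (proj1 hr); ring.
    + assert (E := proj2 (proj2 hr) z ltac:(lia)).
      apply (f_equal (fun x => RtoC (IZR x))) in E.
      rewrite RtoC_Zsum in E.
      simpl csum at 1; rewrite Z.sub_0_r.
      unfold r_val at 1; rewrite E.
      replace (jacobi_coeff 0) with (RtoC 1) by (unfold jacobi_coeff; simpl; ring).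
      match goal with |- _ + _ * ?A + ?B = _ => assert (HAB : B = (- (1)) * A) end.
      * rewrite <- csum_scal; apply csum_ext; intros i _.
        rewrite !mult_IZR, !RtoC_mult, RtoC_sign, plus_IZR, mult_IZR, <- INR_IZR_INZ.
        unfold jacobi_coeff, r_val; rewrite RtoC_plus, RtoC_mult.
        replace (1 + i - 1)%nat with i by lia; rewrite Cpow_add_r, Cpow_1_r; ring.
      * rewrite HAB; ring.
Qed.

(* [rtilde] extended to all indices below [N], negative ones included. *)
Definition rtilde_ext (r : Z -> Z) (m j N : nat) (z : Z) : C :=
  csum N (fun l => RtoC (IZR (alt_coeff m j l)) * r_val r (z - Z.of_nat l)).

Lemma rtilde_csum (r : Z -> Z) (m j N k : nat) : is_r r -> (k < N)%nat ->
  RtoC (IZR (rtilde r m j k)) = rtilde_ext r m j N (Z.of_nat k).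
Proof.
  intros hr Hk; unfold rtilde, rtilde_ext; rewrite RtoC_Zsum, csum_rev.
  rewrite (csum_extend (k + 1) N); [|lia|].
  - apply csum_ext; intros i Hi; rewrite !Nat.add_0_l.
    replace (k - (k + 1 - 1 - i))%nat with i by lia.
    rewrite mult_IZR, RtoC_mult; unfold r_val.
    replace (Z.of_nat (k + 1 - 1 - i)) with (Z.of_nat k - Z.of_nat i)%Z by lia; ring.
  - intros i Hi; rewrite r_val_neg by (exact hr || lia); ring.
Qed.

(** Exchanging the sums lets Jacobi's series cancel [r], leaving the alternating polynomial;
    [k < tri j] makes the [j]-term truncation exact in this degree. *)
Lemma rtilde_recurrence (r : Z -> Z) (m j N k : nat) :
  is_r r -> (k < N)%nat -> (k < tri j)%nat ->
  csum j (fun v => jacobi_coeff v * rtilde_ext r m j N (Z.of_nat k - Z.of_nat (tri v)))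
  = RtoC (IZR (alt_coeff m j k)).
Proof.
  intros hr Hk Hkj; unfold rtilde_ext.
  rewrite (csum_ext j _ (fun v => csum N (fun l =>
    RtoC (IZR (alt_coeff m j l)) * (jacobi_coeff v * r_val r (Z.of_nat k - Z.of_nat l - Z.of_nat (tri v)))))).
  2: { intros v _; rewrite <- csum_scal; apply csum_ext; intros l _.
       replace (Z.of_nat k - Z.of_nat (tri v) - Z.of_nat l)%Z
         with (Z.of_nat k - Z.of_nat l - Z.of_nat (tri v))%Z by lia; ring. }
  rewrite csum_exchange.
  rewrite (csum_ext N _ (fun l => RtoC (IZR (alt_coeff m j l)) * (if Z.eqb (Z.of_nat k - Z.of_nat l) 0 then 1 else 0))).
  2: { intros l _; rewrite csum_scal, r_inverse by (exact hr || lia); reflexivity. }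
  rewrite (csum_single N k); [|exact Hk|].
  - rewrite Z.sub_diag; simpl; ring.
  - intros i Hi; rewrite (proj2 (Z.eqb_neq _ 0)) by lia; ring.
Qed.

(** Jacobi's series has constant term 1, so the relation determines each coefficient from the
    earlier ones, and [rtilde] satisfies the same relation. *)
Lemma coeffs_unique (r : Z -> Z) (m j : nat) (g : nat -> C) (N : nat) :
  is_r r -> (N <= tri j)%nat ->
  (forall k, (k < N)%nat ->
    csum j (fun v => jacobi_coeff v *
      (if Nat.leb (tri v) k then g (k - tri v)%nat else 0)) = RtoC (IZR (alt_coeff m j k))) ->
  forall k, (k < N)%nat -> g k = RtoC (IZR (rtilde r m j k)).
Proof.
  intros hr HN Hg k; induction k as [k IH] using lt_wf_ind; intros Hk.
  assert (E := eq_trans (Hg k Hk) (eq_sym (rtilde_recurrence r m j N k hr Hk ltac:(lia)))).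
  assert (Hj : (1 <= j)%nat).
  { destruct j; [change (tri 0) with 0%nat in HN|]; lia. }
  rewrite !(csum_head j) in E by exact Hj.
  rewrite (csum_ext (j - 1) _ (fun i => jacobi_coeff (1 + i) *
    rtilde_ext r m j N (Z.of_nat k - Z.of_nat (tri (1 + i))))) in E.
  - rewrite (rtilde_csum r m j N k hr Hk).
    change (tri 0) with 0%nat in E; simpl Nat.leb in E; cbv iota in E.
    rewrite Nat.sub_0_r, Z.sub_0_r in E.
    replace (jacobi_coeff 0) with (RtoC 1) in E by (unfold jacobi_coeff; simpl; ring).
    match type of E with _ + ?B = _ =>
      replace (g k) with (1 * g k + B - B) by ring; rewrite E; ring end.
  (* The induction hypothesis covers [tri (1 + i) <= k]; otherwise the default 0 agrees with
     [rtilde_ext] at a negative index. *)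
  - intros i _; f_equal.
    assert (H1 := tri_ge (1 + i)).
    destruct (Nat.leb_spec (tri (1 + i)) k).
    + rewrite IH, (rtilde_csum r m j N) by (exact hr || lia); f_equal; lia.
    + symmetry; apply csum_zero; intros l _; rewrite r_val_neg by (exact hr || lia); ring.
Qed.

Lemma alt_coeff_csum (m j k : nat) :
  RtoC (IZR (alt_coeff m j k)) =
  csum m (fun s => (- (1)) ^ s * (if Nat.eqb (s * j + tri s) k then 1 else 0)).
Proof.
  unfold alt_coeff; rewrite RtoC_Zsum; apply csum_ext; intros s _; rewrite Nat.add_0_l.
  destruct (Nat.eqb (s * j + tri s) k); [rewrite RtoC_sign|]; ring.
Qed.

(** Since [theta_slope] is a polynomial in [q], its product with [S] is a finite combination of
    shifts of the series [g]. *)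
Lemma expands_slope_minus_alt (m j : nat) (g : nat -> C) (S : C -> C) :
  expands g S ->
  expands (fun k =>
      csum j (fun v => jacobi_coeff v *
        (if Nat.leb (tri v) k then g (k - tri v)%nat else 0))
      + (- (1)) * RtoC (IZR (alt_coeff m j k)))
    (fun q => S q * theta_slope j q - alt_poly m j q).
Proof.
  intros Hg.
  assert (H1 := expands_csum j _ _ (fun v _ =>
    expands_scal (jacobi_coeff v) _ _ (expands_shift (tri v) g S Hg))).
  assert (H2 := expands_scal (- (1)) _ _ (expands_csum m _ _ (fun s _ =>
    expands_scal ((- (1)) ^ s) _ _ (expands_pow (s * j + tri s))))).
  generalize (expands_plus _ _ _ _ H1 H2); apply near0_imp; intros q H.
  replace (S q * theta_slope j q - alt_poly m j q) with
    (csum j (fun v => jacobi_coeff v * (q ^ tri v * S q)) +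
     - (1) * csum m (fun s => (- (1)) ^ s * q ^ (s * j + tri s))).
  - revert H; apply cseries_ext; intro k; rewrite alt_coeff_csum; reflexivity.
  - unfold alt_poly, theta_slope; rewrite <- (csum_scal j (S q)).
    unfold Cminus; f_equal; [|ring].
    apply csum_ext; intros v _; ring.
Qed.

(** * The numerical hypotheses and the conclusion *)

(** Squaring [2j - 2m + 1 >= sqrt (8m^2 + 1)] gives [j(j+1) >= m(m+1) + 2mj], and the bound on [k]
    simplifies to [mj + m(m+1)/2 - 1]. *)
Lemma index_bounds (m j k : nat) :
  ((2 * INR m - 1 + sqrt (8 * INR m ^ 2 + 1)) / 2 <= INR j)%R ->
  (INR k <= (INR m + 2 * INR j) * (INR m + 1) / 2 - 1 - INR j)%R ->
  (m * j + tri m <= tri j)%nat /\ (k < m * j + tri m)%nat.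
Proof.
  intros Hj Hk.
  assert (Hm2 : (2 * INR (tri m) = INR m * (INR m + 1))%R).
  { rewrite <- (S_INR m), <- mult_INR, <- Nat.add_1_r, <- tri_double, mult_INR; reflexivity. }
  assert (Hj2 : (2 * INR (tri j) = INR j * (INR j + 1))%R).
  { rewrite <- (S_INR j), <- mult_INR, <- Nat.add_1_r, <- tri_double, mult_INR; reflexivity. }
  split.
  - assert (H0 : (0 <= 8 * INR m ^ 2 + 1)%R) by nra.
    assert (Hs := sqrt_sqrt _ H0); assert (Hs0 := sqrt_pos (8 * INR m ^ 2 + 1)).
    apply INR_le; rewrite plus_INR, mult_INR; nra.
  - apply INR_lt; rewrite plus_INR, mult_INR; nra.
Qed.

Theorem theorem1 (m j : nat) (hm : (1 <= m)%nat) (hj : (1 <= j)%nat)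
    (hmj : ((2 * INR m - 1 + sqrt (8 * INR m ^ 2 + 1)) / 2 <= INR j)%R)
    (xi : C -> C) (hxi : jth_zero j (fun q => - xi q)%C)
    (g : nat -> C) (hg : laurent_coeffs j xi g)
    (r : Z -> Z) (hr : is_r r)
    (k : nat)
    (hk : (INR k <= (INR m + 2 * INR j) * (INR m + 1) / 2 - 1 - INR j)%R) :
  g k = RtoC (IZR (rtilde r m j k)).
Proof.
  destruct (index_bounds m j k hmj hk) as [HN Hk].
  (* Obtained by solving [xi = q^(-j) (1 - d)] with [d = (-1)^j q^(tri j) S]; the sign is its own
     inverse. *)
  set (S := fun q => (- (1)) ^ j * (1 - q ^ j * xi q) / q ^ tri j).
  assert (Hsq : (- (1)) ^ j * (- (1)) ^ j = 1).
  { rewrite <- Cpow_add_r; replace (j + j)%nat with (2 * j)%nat by lia; apply sign_even. }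
  (* Factoring out [q^(-j)] raises the Laurent exponent [j(j-1)/2] by [j], to [tri j]. *)
  assert (HT : tri j = (j + j * (j - 1) / 2)%nat).
  { generalize (shifted_tri_eq j j hj) (shifted_tri_ge j 0).
    rewrite Nat.add_0_r; intros H1 H2; rewrite H2 in H1.
    generalize (tri_double j); change (tri 0) with 0%nat in H1; nia. }
  assert (Hexp : expands g S).
  { destruct hg as [_ [rho [Hrho Hl]]].
    exists rho; split; [exact Hrho|]; intros q Hq.
    assert (Hq0 : q <> 0) by (apply Cmod_gt_0; lra).
    destruct (Hl q Hq) as [S0 [Hser Heq]].
    replace (S q) with S0; [exact Hser|].
    unfold S; rewrite HT, Cpow_add_r.
    assert (Ha := Cpow_nz q j Hq0).
    assert (Hb := Cpow_nz q (j * (j - 1) / 2) Hq0).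
    replace (xi q) with (- - xi q) by ring; rewrite Heq.
    transitivity ((- (1)) ^ j * (- (1)) ^ j * S0); [rewrite Hsq; ring|].
    field; split; assumption. }
  apply (coeffs_unique r m j g (m * j + tri m) hr HN); [|exact Hk].
  intros i Hi.
  assert (Hbig : bigO (m * j + tri m) (fun q => S q * theta_slope j q - alt_poly m j q)).
  { apply theta_zero_first_order; [exact hj | exact HN | | exact (expands_bounded g S Hexp)].
    exists (108 / 1000)%R; split; [lra|]; intros q Hq.
    assert (Hq0 : q <> 0) by (apply Cmod_gt_0; lra).
    assert (Ha := Cpow_nz q j Hq0); assert (Hb := Cpow_nz q (tri j) Hq0).
    apply theta_rescale with (3 := eq_refl); [exact hj | exact Hq0 |].
    replace (- / q ^ j * (1 - (- (1)) ^ j * q ^ tri j * S q)) with (- xi q).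
    - apply (proj1 hxi); lra.
    - replace ((- (1)) ^ j * q ^ tri j * S q) with
        ((- (1)) ^ j * (- (1)) ^ j * (1 - q ^ j * xi q))
        by (unfold S; field; exact Hb).
      rewrite Hsq; field; exact Ha. }
  (* All coefficients below the order of vanishing are zero, which is the relation required by
     [coeffs_unique]. *)
  assert (E := expands_vanish _ _ _ (expands_slope_minus_alt m j g S Hexp) Hbig i Hi).
  cbv beta in E; match type of E with ?A + _ * ?B = _ =>
    transitivity (A + - (1) * B + B); [ring | rewrite E; ring] end.
Qed.
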